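(* Under the minimum degree weighting scheme, $\mathbf{COV}[G]=O(n^2\log n)$; that is, there is a universal constant $C$ such that for every finite, simple, connected, undirected graph $G$ with $n\ge2$ vertices, the cover time of the min-deg weighted random walk on $G$ is at most $C\,n^2\log n$.
   Context: Minimum degree (min-deg) weighting scheme: each edge $(u,v)\in E(G)$ is given weight $w(u,v)=1/\min\{d(u),d(v)\}$, where $d(\cdot)$ is vertex degree in $G$. The weighted random walk moves from $u$ to a neighbour $v\in N(u)$ with probability $$P_{u,v}=\frac{1/\min\{d(u),d(v)\}}{\sum_{x\in N(u)}1/\min\{d(u),d(x)\}}.$$ The cover time $\mathbf{COV}[G]$ of the weighted walk is the maximum over starting vertices $u$ of the expected number of steps for the walk started at $u$ to visit every vertex of $G$. *)

(* Defs.v *)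
From HB Require Import structures.
From mathcomp Require Import all_boot all_order all_algebra.
From mathcomp Require Import all_classical all_reals all_analysis.

Set Implicit Arguments.
Unset Strict Implicit.
Unset Printing Implicit Defensive.
Import Order.TTheory GRing.Theory Num.Theory.

Local Open Scope classical_set_scope.
Local Open Scope ring_scope.

Record sgraph := SGraph {
  vertex :> finType;
  adj : rel vertex;
  adj_sym : symmetric adj;
  adj_irrefl : irreflexive adj }.

Definition deg (G : sgraph) (u : G) : nat := #|adj u|.

Definition connected_graph (G : sgraph) : Prop :=
  forall u v : G, connect (@adj G) u v.

Section weighted_walk.
Variables (R : realType) (G : sgraph).

Definition weighted_trans (w : G -> G -> R) (u v : G) : R :=
  if adj u v then w u v / \sum_(x | adj u x) w u x else 0.

Definition mindeg_weight (u v : G) : R := (minn (deg u) (deg v))%:R^-1.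

End weighted_walk.

(* The trajectories form the same type [nat -> V] for every [u]; the parameter
   only makes the type pointed, as measurable types have to be. *)
Definition traj (V : finType) (u : V) := nat -> V.

HB.instance Definition _ (V : finType) (u : V) := Choice.on (traj u).
HB.instance Definition _ (V : finType) (u : V) :=
  isPointed.Build (traj u) (fun=> u).

Definition coordinate_events (V : finType) (u : V) : set (set (traj u)) :=
  [set [set X : traj u | X tv.1 = tv.2] | tv in [set: nat * V]].

(* [nat -> V] with the product sigma-algebra *)
Notation path_space u := (g_sigma_algebraType (@coordinate_events _ u)).

Section chain_law.
Variables (R : realType) (V : finType) (P : V -> V -> R) (u : V).

Definition cylinder (x : nat -> V) (t : nat) : set (path_space u) :=
  [set X | forall i, (i <= t)%N -> X i = x i].

(* Pr(X_0 = u) = 1 and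
   Pr(X_0 = x_0, ..., X_t = x_t, X_{t+1} = x_{t+1})
     = Pr(X_0 = x_0, ..., X_t = x_t) P(x_t, x_{t+1}) *)
Definition is_chain_law (mu : probability (path_space u) R) : Prop :=
  mu [set X | X 0%N = u] = 1%E /\
  forall (x : nat -> V) (t : nat),
    mu (cylinder x t.+1) = (mu (cylinder x t) * (P (x t) (x t.+1))%:E)%E.

(* The law exists when P is stochastic ([chain_lawP]), and it is then unique
   ([is_chain_law_unique]); [get] returns a junk value otherwise. *)
Definition chain_law : probability (path_space u) R :=
  get [set mu | is_chain_law mu].

End chain_law.

Arguments cylinder {V} u x t.

Section cover_time.
Variables (R : realType) (V : finType).

(* first time by which all vertices have been visited; +oo if there is none *)
Definition cover_time (X : nat -> V) : \bar R :=
  ereal_inf [set t%:R%:E |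
    t in [set t : nat | forall v, exists2 s, (s <= t)%N & X s = v]].

Definition expected_cover_time (P : V -> V -> R) (u : V) : \bar R :=
  (\int[chain_law P u]_X cover_time X)%E.

End cover_time.

Definition COV (R : realType) (G : sgraph) (w : G -> G -> R) : \bar R :=
  \big[maxe/-oo%E]_(u : G) expected_cover_time (weighted_trans w) u.

(* A uniform point of [0, 1[ drives a chain with transition matrix [P]. *)
Section chain_law_exists.
Variables (R : realType) (V : finType) (P : V -> V -> R) (u : V).
Hypothesis P0 : forall v w, 0 <= P v w.
Hypothesis P1 : forall v, \sum_w P v w = 1.

Let S v k : R := \sum_(0 <= i < k) P v (nth u (enum V) i).

Let S0 v : S v 0 = 0.
Proof. by rewrite /S big_geq. Qed.

Let Smono v i j : (i <= j)%N -> S v i <= S v j.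
Proof.
move=> ij; rewrite /S (big_cat_nat (n := i) (p := j))//= lerDl.
by apply: sumr_ge0 => k _; exact: P0.
Qed.

Let S1 v : S v #|V| = 1.
Proof.
rewrite -(P1 v) /S -[RHS]big_enum/= [RHS](big_nth u) -cardE.
by [].
Qed.

Let c v w := S v (index w (enum V)).

Let cS v w : c v w + P v w = S v (index w (enum V)).+1.
Proof. by rewrite /c /S big_nat_recr//= nth_index// mem_enum. Qed.

Let c_ge0 v w : 0 <= c v w.
Proof. by rewrite -(S0 v); exact: Smono. Qed.

Let cP_le1 v w : c v w + P v w <= 1.
Proof. by rewrite cS -(S1 v) Smono// cardE index_mem mem_enum. Qed.

Let inc v w y := (c v w <= y) && (y < c v w + P v w).

Let inc_uniq v w1 w2 y : inc v w1 y -> inc v w2 y -> w1 = w2.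
Proof.
rewrite /inc !cS => /andP[a1 b1] /andP[a2 b2].
suff : index w1 (enum V) = index w2 (enum V).
  by move/(congr1 (nth u (enum V))); rewrite !nth_index ?mem_enum.
case: (ltngtP (index w1 (enum V)) (index w2 (enum V))) => // h.
- have := lt_le_trans b1 (le_trans (Smono v h) a2).
  by rewrite ltxx.
- have := lt_le_trans b2 (le_trans (Smono v h) a1).
  by rewrite ltxx.
Qed.

Let inc_ex v y : 0 <= y < 1 -> exists w, inc v w y.
Proof.
move=> /andP[y0 y1].
have ex : exists k, y < S v k by exists #|V|; rewrite S1.
case: (ex_minnP ex) => -[|k]; first by rewrite S0 ltNge y0.
move=> yk mink.
have kV : (k < #|V|)%N by apply: mink; rewrite S1.
exists (nth u (enum V) k); rewrite /inc cS /c.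
rewrite index_uniq ?enum_uniq -?cardE// yk andbT leNgt.
by apply/negP => /mink; rewrite ltnn.
Qed.

Let next v y := odflt v [pick w | inc v w y].

Let nextP v y : 0 <= y < 1 -> inc v (next v y) y.
Proof.
move=> /(inc_ex v)[w vw]; rewrite /next; case: pickP => //= /(_ w).
by rewrite vw.
Qed.

Let step (s : V * R) : V * R :=
  let w := next s.1 s.2 in (w, (s.2 - c s.1 w) / P s.1 w).

Let walk v y t : V := (iter t step (v, y)).1.

Let cyl_itv t : forall v (x : nat -> V),
  let p := \prod_(i < t) P (x i) (x i.+1) in
  exists a, [/\ 0 <= a, 0 <= p, a + p <= 1 &
    forall y, 0 <= y < 1 ->
    (forall i, (i <= t)%N -> walk v y i = x i) <->
    (x 0%N = v /\ a <= y < a + p)].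
Proof.
elim: t => [|t IH] v x /=.
  exists 0; rewrite big_ord0; split; rewrite ?add0r// => y y01.
  split=> [/(_ 0%N erefl) /=|[xv _] i]; first by rewrite /walk/= => ->.
  by rewrite leqn0 => /eqP ->; rewrite /walk/= xv.
have [a [a0 p0 ap1 H]] := IH (x 1%N) (fun i => x i.+1).
rewrite big_ord_recl /=; under eq_bigr do rewrite /bump /= add1n.
set p := \prod_(i < t) _ in p0 ap1 H *.
set q := P (x 0%N) (x 1%N).
have q0 : 0 <= q by exact: P0.
exists (c (x 0%N) (x 1%N) + q * a).
have cq : c (x 0%N) (x 1%N) + q * a + q * p <= c (x 0%N) (x 1%N) + q.
  by rewrite -addrA -mulrDr lerD2l ler_piMr.
split.
- by rewrite addr_ge0// mulr_ge0.
- exact: mulr_ge0.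
- by apply: (le_trans cq); exact: cP_le1.
move=> y y01; split.
- move=> A.
  have xv : x 0%N = v by rewrite -(A 0%N)// /walk.
  have nx : next v y = x 1%N by rewrite -(A 1%N).
  have := nextP v y01; rewrite nx -xv => /andP[cy yc].
  have q_gt0 : 0 < q by move: (le_lt_trans cy yc); rewrite ltrDl.
  split=> //.
  set y' := (y - c (x 0%N) (x 1%N)) / q.
  have y'01 : 0 <= y' < 1.
    rewrite /y' divr_ge0 ?subr_ge0//= ltr_pdivrMr// mul1r ltrBlDl//.
  have [] := H y' y'01.
  case=> [i it|_ /andP[ay yap] _].
    by rewrite -(A i.+1)// /walk iterSr /step/= nx -xv.
  have -> : y = c (x 0%N) (x 1%N) + q * y'.
    by rewrite /y' mulrCA divff ?gt_eqF// mulr1 addrC subrK.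
  by rewrite -addrA -mulrDr lerD2l ler_pM2l// ltrD2l ltr_pM2l// ay.
- move=> [xv /andP[ay yap]].
  have q_gt0 : 0 < q.
    rewrite lt_neqAle q0 andbT; apply/eqP => q00.
    by move: (le_lt_trans ay yap); rewrite -q00 !mul0r !addr0 ltxx.
  have incy : inc v (x 1%N) y.
    rewrite -xv; apply/andP; split; last exact: lt_le_trans cq.
    by apply: le_trans ay; rewrite lerDl mulr_ge0.
  have nx : next v y = x 1%N by apply: inc_uniq (nextP v y01) incy.
  set y' := (y - c (x 0%N) (x 1%N)) / q.
  have y'01 : 0 <= y' < 1.
    move: incy; rewrite -xv => /andP[h1 h2].
    by rewrite /y' divr_ge0 ?subr_ge0//= ltr_pdivrMr// mul1r ltrBlDl.
  have yE : y = c (x 0%N) (x 1%N) + q * y'.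
    by rewrite /y' mulrCA divff ?gt_eqF// mulr1 addrC subrK.
  have [_ B] := H y' y'01.
  case=> [_|i it]; first by rewrite /walk/= xv.
  have -> : walk v y i.+1 = walk (x 1%N) y' i.
    by rewrite /walk iterSr /step/= nx -xv.
  apply: B => //; split=> //; move: ay yap; rewrite {1 2}yE.
  by rewrite -addrA -mulrDr lerD2l ler_pM2l// ltrD2l ltr_pM2l// => -> ->.
Qed.

Let I01 : set R := `[0, 1[%classic.

Let mI01 : measurable (I01 : set (measurableTypeR R)).
Proof. exact: measurable_itv. Qed.

Let phi (y : measurableTypeR R) : path_space u :=
  if 0 <= y < 1 then walk u y else fun=> u.

Let cyl_phi t (x : nat -> V) : exists a,
  let p := \prod_(i < t) P (x i) (x i.+1) in
  0 <= p /\
  phi @^-1` (cylinder u x t) `&` I01 =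
    (if x 0%N == u then `[a, a + p[%classic else set0).
Proof.
have [a [a0 p0 ap1 H]] := cyl_itv t u x.
exists a; split=> //; apply/seteqP; split=> y /=.
- move=> -[A]; rewrite /I01/= in_itv/= => y01.
  have : forall i, (i <= t)%N -> walk u y i = x i.
    by move=> i it; have := A i it; rewrite /phi y01.
  by move=> /(H y y01) [-> ay]; rewrite eqxx/= in_itv.
- case: eqP => //= xu; rewrite in_itv/= => ay.
  have y01 : 0 <= y < 1.
    case/andP: ay => ay yap; rewrite (le_trans a0 ay)/=.
    exact: lt_le_trans yap ap1.
  split; last by rewrite /I01/= in_itv.
  by rewrite /cylinder/= /phi y01; apply/(H y y01).
Qed.

Let mphi : measurable_fun setT phi.
Proof.
apply: (@measurability _ _ (measurableTypeR R) (path_space u) setT phi (@coordinate_events V u)) => // A.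
case=> _ [[t v] _ <-] <- /=; rewrite setTI.
pose ext (f : {ffun 'I_t.+1 -> V}) (i : nat) : V := f (inord i).
rewrite [X in measurable X](_ : _ =
  (\bigcup_(f in [set f : {ffun 'I_t.+1 -> V} | f ord_max = v])
     (phi @^-1` (cylinder u (ext f) t) `&` I01)) `|`
  (~` I01 `&` [set _ | u = v])).
  apply: measurableU.
    apply: fin_bigcup_measurable => [|f _]; first exact: finite_finset.
    have [a [_ ->]] := cyl_phi t (ext f).
    by case: ifP => _ //; exact: measurable_itv.
  apply: measurableI; first exact: measurableC.
  have [uv|uv] := pselect (u = v).
    by rewrite (_ : [set _ | _] = setT)//; apply/seteqP; split.
  by rewrite (_ : [set _ | _] = set0)//; apply/seteqP; split.
apply/seteqP; split=> y /=.
  move=> yv; have [y01|y01] := boolP (0 <= y < 1); last first.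
    right; split; first by rewrite /I01/= in_itv/=; exact/negP.
    by move: yv; rewrite /phi (negbTE y01).
  left; exists [ffun i : 'I_t.+1 => phi y i]; rewrite /= ?ffunE//.
  split; last by rewrite /I01/= in_itv.
  by move=> i it; rewrite /ext ffunE inordK.
case=> [[f /= fv [B _]]|[]].
  rewrite (B t)// /ext -fv; congr (f _).
  by apply/val_inj; rewrite /= inordK.
rewrite /I01/= in_itv/= => /negP y01 <-.
by rewrite /phi (negbTE y01).
Qed.

Let nu := pushforward (mrestr (@lebesgue_measure R) mI01) phi.

Let nuE (x : nat -> V) t :
  nu (cylinder u x t) =
    ((x 0%N == u)%:R * \prod_(i < t) P (x i) (x i.+1))%:E.
Proof.
rewrite /nu /pushforward /mrestr; have [a [p0 ->]] := cyl_phi t x.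
case: eqP => xu; rewrite ?mul0r ?measure0// mul1r lebesgue_measure_itv/=.
rewrite lte_fin ltrDl; case: ltP => [_|p_le0].
  by rewrite -EFinD addrAC subrr add0r.
by congr EFin; apply/eqP; rewrite eq_le p0 p_le0.
Qed.

Lemma chain_lawP : is_chain_law P (chain_law P u).
Proof.
apply: getPex.
pose m : {measure set (path_space u) -> \bar R} :=
  @measure_function_pushforward__canonical__measure_function_Measure
    _ _ _ _ R (mrestr (@lebesgue_measure R) mI01) phi mphi.
have mT : m setT = 1%E.
  rewrite /m/= /pushforward preimage_setT /mrestr setTI lebesgue_measure_itv/=.
  by rewrite lte_fin ltr01 oppr0 adde0.
have mE A : mnormalize m (dirac point) A = m A.
  by rewrite /mnormalize mT/= onee_eq0/= invr1 mule1.
have mcylE (x : nat -> V) t : m (cylinder u x t) =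
    ((x 0%N == u)%:R * \prod_(i < t) P (x i) (x i.+1))%:E by exact: nuE.
pose pm : probability (path_space u) R := mnormalize m (dirac point).
exists pm; split=> [|x t].
  rewrite /= mE (_ : [set X | _] = cylinder u (fun=> u) 0).
    by rewrite mcylE eqxx big_ord0 mulr1.
  apply/seteqP; split=> X /=; last exact.
  by move=> X0 i; rewrite leqn0 => /eqP ->.
by rewrite /= !mE !mcylE big_ord_recr/= mulrA EFinM.
Qed.

End chain_law_exists.

Section chain_law_unique.
Variables (R : realType) (V : finType) (P : V -> V -> R) (u : V).

Lemma measurable_cylinder (x : nat -> V) t :
  measurable (cylinder u x t).
Proof.
rewrite (_ : cylinder u x t =
  \bigcap_(i in [set i | (i <= t)%N]) [set X : path_space u | X i = x i]).
  apply: bigcap_measurable; first by exists 0%N.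
  by move=> i _; apply: sub_sigma_algebra; exists (i, x i).
by apply/seteqP; split.
Qed.

Lemma measurable_coordinate t v :
  measurable [set X : path_space u | X t = v].
Proof. by apply: sub_sigma_algebra; exists (t, v). Qed.

Lemma chain_law_cylinder (mu : probability (path_space u) R) x t :
  is_chain_law P mu ->
  mu (cylinder u x t) =
    ((x 0%N == u)%:R * \prod_(i < t) P (x i) (x i.+1))%:E.
Proof.
move=> [mu0 muS]; elim: t => [|t IH]; last first.
  by rewrite muS IH big_ord_recr/= mulrA EFinM.
rewrite big_ord0 mulr1; have [xu|xu] := eqVneq.
  rewrite -[RHS]mu0; congr (mu _); apply/seteqP; split=> X /=.
    by move=> ->.
  by move=> X0 i; rewrite leqn0 => /eqP ->; rewrite xu.
rewrite mulr0n; apply/eqP; rewrite eq_le measure_ge0 andbT.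
have m0 := measurable_coordinate 0 u.
have mC0 : mu (~` [set X : path_space u | X 0%N = u]) = 0%E.
  by rewrite probability_setC// [X in (1 - X)%E](_ : _ = 1%E)// subee.
apply: (@le_trans _ _ (mu (~` [set X : path_space u | X 0%N = u]))); last first.
  by rewrite [leLHS](_ : _ = 0%E).
apply: le_measure; rewrite ?inE; [exact: measurable_cylinder|exact: measurableC|].
by move=> X /= /(_ 0%N erefl) -> /eqP; apply/negP.
Qed.

Lemma is_chain_law_unique (mu1 mu2 : probability (path_space u) R) :
  is_chain_law P mu1 -> is_chain_law P mu2 ->
  forall A, measurable A -> mu1 A = mu2 A.
Proof.
move=> h1 h2.
pose G : set (set (traj u)) :=
  [set A | [\/ A = set0, A = setT | exists x t, A = cylinder u x t]].
have GI : setI_closed G.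
  move=> A B [->|->|[x [t ->]]]; rewrite ?set0I ?setTI; [by constructor 1|by []|].
  case=> [->|->|[y [s ->]]]; rewrite ?setI0 ?setIT.
  - by constructor 1.
  - by constructor 3; exists x, t.
  wlog ts : x t y s / (t <= s)%N => [H|].
    by have [/H//|/ltnW/H] := leqP t s; rewrite setIC; exact.
  have [xy|xy] := pselect (forall i, (i <= t)%N -> x i = y i).
    constructor 3; exists y, s; apply/seteqP; split=> X /=; first by case.
    by move=> Xy; split=> // i it; rewrite xy// Xy// (leq_trans it).
  constructor 1; apply/seteqP; split=> X //= -[Xx Xy].
  by apply: xy => i it; rewrite -Xx// -Xy// (leq_trans it).
have sub : forall A : set (path_space u), measurable A -> <<s G >> A.
  apply: smallest_sub; first exact: smallest_sigma_algebra.
  move=> _ [[t v] _ <-] /=.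
  pose ext (f : {ffun 'I_t.+1 -> V}) (i : nat) : V := f (inord i).
  rewrite (_ : [set _ | _] =
    \bigcup_(f in [set f : {ffun 'I_t.+1 -> V} | f ord_max = v])
      (cylinder u (ext f) t)).
    apply: (@fin_bigcup_measurable _ (g_sigma_algebraType G)) => [|f _].
      exact: finite_finset.
    by apply: sub_sigma_algebra; constructor 3; exists (ext f), t.
  apply/seteqP; split=> X /=.
    move=> Xv; exists [ffun i : 'I_t.+1 => X i]; rewrite /= ?ffunE//.
    by move=> i it; rewrite /ext ffunE inordK.
  move=> [f /= <- Xf]; rewrite (Xf t)// /ext; congr (f _).
  by apply/val_inj; rewrite /= inordK.
move=> A mA.
apply: (@g_sigma_algebra_measure_unique _ R (path_space u) G _ (fun=> setT)
  _ _ mu1 mu2) => //.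
- by move=> B [->|->|[x [t ->]]] //; exact: measurable_cylinder.
- by move=> _; constructor 2.
- by rewrite bigcup_const.
- move=> B [->|->|[x [t ->]]].
  + exact: etrans (measure0 mu1) (esym (measure0 mu2)).
  + exact: etrans (probability_setT mu1) (esym (probability_setT mu2)).
  + exact: etrans (chain_law_cylinder x t h1)
                  (esym (chain_law_cylinder x t h2)).
- by move=> _; rewrite [ltLHS](probability_setT mu1) ltry.
- exact: sub.
Qed.

End chain_law_unique.

Section mindeg_stochastic.
Variables (R : realType) (G : sgraph).
Hypothesis Gconn : connected_graph G.
Hypothesis G2 : (2 <= #|G|)%N.

Let W := weighted_trans (@mindeg_weight R G).

Lemma connected_neighbour (v : G) : exists w, adj v w.
Proof.
have [w wv] : exists w : G, w != v.
  have : (0 < #|predC1 v|)%N by rewrite cardC1 -subn1 subn_gt0.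
  by move=> /card_gt0P[w wv]; exists w.
have /connectP[[|x p] /=] := Gconn v w; first by move=> _ wE; rewrite wE eqxx in wv.
by move=> /andP[vx _] _; exists x.
Qed.

Lemma mindeg_trans_ge0 v w : 0 <= W v w.
Proof.
rewrite /W /weighted_trans; case: ifP => // _; rewrite divr_ge0 ?invr_ge0//.
by apply: sumr_ge0 => x _; rewrite invr_ge0.
Qed.

Lemma mindeg_trans_sum1 v : \sum_w W v w = 1.
Proof.
rewrite /W /weighted_trans -big_mkcond/= -mulr_suml divff//.
have [w vw] := connected_neighbour v.
have deg_gt0 (a b : G) : adj a b -> (0 < deg a)%N.
  by move=> ab; apply/card_gt0P; exists b.
rewrite gt_eqF// (bigD1 w)//= ltr_pwDl//.
  rewrite invr_gt0 ltr0n leq_min (deg_gt0 v w)//=.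
  by rewrite (deg_gt0 w v)// adj_sym.
by apply: sumr_ge0 => x _; rewrite invr_ge0.
Qed.

Lemma mindeg_lawP (u : G) : is_chain_law W (chain_law W u).
Proof.
by apply: chain_lawP; [exact: mindeg_trans_ge0|exact: mindeg_trans_sum1].
Qed.

End mindeg_stochastic.

(* Main.v *)
Require Import Defs.
From mathcomp Require Import all_boot all_order all_algebra.
From mathcomp Require Import all_classical all_reals all_analysis.
From mathcomp Require Import measurable_realfun ring lra zify.
Import Order.TTheory GRing.Theory Num.Theory.

(** Let h(x) be the expected time, truncated at N, of the walk from x before it
    visits v. Off v, h satisfies w(x) h(x) - sum_y w(x,y) h(y) <= w(x), where
    w(x) = sum_y w(x,y); multiplying by h(x) and summing, its Dirichlet energy
    is at most max h times the total weight, which is at most 2n because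
    1/min(d, d') <= 1/d + 1/d'. A shortest path from v to a maximum of h has
    total degree at most 3n, so Cauchy-Schwarz along it gives
    max h <= 12 n^2. Hence in any 24 n^2 steps the walk hits v with probability
    at least 1/2, and after log_2 n such rounds a union bound over v applies. *)

Set Implicit Arguments.
Unset Strict Implicit.
Unset Printing Implicit Defensive.

Local Open Scope classical_set_scope.
Local Open Scope ring_scope.

Lemma nth_last_take (T : Type) (d u : T) (p : seq T) i :
  (i <= size p)%N -> nth d (u :: p) i = last u (take i p).
Proof. by elim: p u i => [|y p IH] u [|i] //= /IH <-. Qed.

Lemma degE (G : sgraph) (x : G) : deg x = (\sum_y adj x y)%N.
Proof. by rewrite /deg -sum1_card big_mkcond. Qed.

(** * Shortest paths and the degrees along them *)

Section shortest_path.
Variable G : sgraph.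
Implicit Types (u v z : G) (p : seq G).

(** A common neighbour of two path vertices gives a detour of length 2 replacing the segment between
    them; minimality of the path forces that segment to have at most 2 edges. *)
Lemma shortest_path u v : connect (@adj G) u v ->
  exists p, [/\ path (@adj G) u p, last u p = v, uniq (u :: p) &
    forall z i j, (i <= j <= size p)%N -> adj (nth u (u :: p) i) z ->
      adj (nth u (u :: p) j) z -> (j <= i + 2)%N].
Proof.
move=> /connectP[q0 q0P q0v].
have ex : exists k, `[< exists p, [/\ path (@adj G) u p, last u p = v & size p = k] >].
  by exists (size q0); apply/asboolP; exists q0.
case: (ex_minnP ex) => k /asboolP[q [qP qv qk]] kmin.
have [p [pP pv pU size_pk]] : exists p : seq G,
    [/\ path (@adj G) u p, last u p = v, uniq (u :: p) & (size p <= k)%N].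
  move: qv; case: (shortenP qP) => p pP pU pq pv; exists p; split=> //.
  by rewrite -qk; apply: uniq_leq_size => //; case/andP: pU.
exists p; split => // z i j ijp iz jz.
have /andP[ij jp] := ijp.
move: iz jz; rewrite !nth_last_take ?(leq_trans ij)// => iz jz.
pose p' := take i p ++ z :: last u (take j p) :: drop j p.
have lt_p : last (last u (take j p)) (drop j p) = v by rewrite -last_cat cat_take_drop.
have /andP[_ dP] : path (@adj G) u (take j p) && path (@adj G) (last u (take j p)) (drop j p).
  by rewrite -cat_path cat_take_drop.
have /andP[tP _] : path (@adj G) u (take i p) && path (@adj G) (last u (take i p)) (drop i p).
  by rewrite -cat_path cat_take_drop.
have : (k <= size p')%N.
  apply: kmin; apply/asboolP; exists p'; split=> //; last by rewrite last_cat.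
  by rewrite cat_path tP /= iz dP adj_sym jz.
rewrite size_cat /= size_take_min size_drop; lia.
Qed.

(* A vertex adjacent to two vertices of a shortest path at distance 3 or more
   along it would provide a shortcut. *)
Lemma shortest_path_deg u v : connect (@adj G) u v ->
  exists p, [/\ path (@adj G) u p, last u p = v, uniq (u :: p) &
    (\sum_(x <- u :: p) deg x <= 3 * #|G|)%N].
Proof.
move=> /shortest_path[p [pP pv pU short]]; exists p; split=> //.
(* Double counting: the degree sum counts, for each [z], the path vertices adjacent to [z], so three
   per [z] is enough. *)
under eq_bigr do rewrite degE.
rewrite exchange_big /= -sum1_card big_distrr /=.
apply: leq_sum => z _; rewrite muln1.
set s := u :: p in pU short *; set a := fun x : G => adj x z.
have -> : (\sum_(x <- s) adj x z)%N = count a s.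
  by elim: (s) => [|x s' IH]; rewrite ?big_nil// big_cons IH.
have [has_a|] := boolP (has a s); last by rewrite has_count -leqNgt leqn0 => /eqP ->.
set m := find a s.
have ms : (m < size s)%N by rewrite -has_find.
have am : a (nth u s m) by exact: nth_find.
have noa (t : seq G) : ~~ has a t -> count a t = 0%N.
  by rewrite has_count -leqNgt leqn0 => /eqP.
(* [m] is the position of the first neighbour of [z]; all others lie at [m + 1] or [m + 2]. *)
rewrite -(cat_take_drop m s) -(cat_take_drop 3 (drop m s)) drop_drop !count_cat.
rewrite (noa (take m s)); last first.
  by apply/hasPn => x /(nthP u)[i]; rewrite size_take ms => im <-; rewrite nth_take// before_find.
rewrite (noa (drop _ s)) ?addn0 ?add0n; last first.
  apply/hasPn => x /(nthP u)[i]; rewrite size_drop => im <-; rewrite nth_drop.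
  apply/negP => az; have := short z m (3 + m + i)%N _ am az.
  by rewrite /s /= in ms im *; lia.
by apply: leq_trans (count_size _ _) _; rewrite size_take; case: ifP; lia.
Qed.

End shortest_path.

(** * The electrical network: conductances, Dirichlet energy, a bound on potentials *)

Section mindeg_conductance.
Variables (R : realType) (G : sgraph).

Definition conductance (x y : G) : R :=
  if adj x y then mindeg_weight R x y else 0.

Definition total_conductance (x : G) : R := \sum_y conductance x y.

Lemma conductance_ge0 x y : 0 <= conductance x y.
Proof. by rewrite /conductance; case: ifP => // _; rewrite invr_ge0. Qed.

Lemma conductance_sym x y : conductance x y = conductance y x.
Proof. by rewrite /conductance adj_sym /mindeg_weight minnC. Qed.

Lemma weighted_transE x y : weighted_trans (@mindeg_weight R G) x y =
  conductance x y / total_conductance x.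
Proof.
rewrite /weighted_trans /total_conductance /conductance -big_mkcond /=.
by case: ifP; rewrite ?mul0r.
Qed.

Lemma adj_deg_gt0 (x y : G) : adj x y -> (0 < deg x)%N.
Proof. by move=> xy; apply/card_gt0P; exists y. Qed.

(** Lets the degree sum of a path bound its resistance, each edge being charged to its first
    endpoint. *)
Lemma conductance_deg x y : adj x y -> 1 <= (deg x)%:R * conductance x y.
Proof.
move=> xy; rewrite /conductance xy /mindeg_weight.
have dx := adj_deg_gt0 xy.
have dy : (0 < deg y)%N by apply: (@adj_deg_gt0 y x); rewrite adj_sym.
by rewrite ler_pdivlMr ?mul1r ?ltr0n ?leq_min ?dx// ler_nat geq_minl.
Qed.

Lemma conductance_le x y :
  conductance x y <= (adj x y)%:R / (deg x)%:R + (adj x y)%:R / (deg y)%:R.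
Proof.
rewrite /conductance; case: ifP => xy; rewrite ?mul0r ?addr0// !mul1r.
rewrite /mindeg_weight; case: leqP => _.
  by rewrite lerDl invr_ge0.
by rewrite lerDr invr_ge0.
Qed.

(** After splitting by [conductance_le], every vertex contributes at most 1 to each of the two sums,
    which agree by symmetry of [adj]. *)
Lemma sum_total_conductance : \sum_x total_conductance x <= 2 * #|G|%:R.
Proof.
have deg_sum (x : G) : \sum_y (adj x y)%:R / (deg x)%:R <= 1 :> R.
  rewrite -mulr_suml -natr_sum.
  rewrite -degE.
  by have [->|d0] := eqVneq (deg x) 0%N; rewrite ?mul0r// divff ?pnatr_eq0.
have S : \sum_(x : G) \sum_y (adj x y)%:R / (deg x)%:R <= #|G|%:R :> R.
  apply: (@le_trans _ _ (\sum_(x : G) 1)); last by rewrite sumr_const.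
  by apply: ler_sum => x _; exact: deg_sum.
apply: (@le_trans _ _ (\sum_(x : G) \sum_y
   ((adj x y)%:R / (deg x)%:R + (adj x y)%:R / (deg y)%:R))).
  by apply: ler_sum => x _; apply: ler_sum => y _; exact: conductance_le.
under eq_bigr do rewrite big_split.
rewrite big_split /= [X in _ + X]exchange_big /=.
under [X in _ + X]eq_bigr => x _ do under eq_bigr => y _ do rewrite adj_sym.
by rewrite mulrDl mul1r lerD.
Qed.

(** The share of [x] in the Dirichlet energy. Summed over all [x], every edge is seen from both
    ends, whence the factor 2 in [sum_local_energy]. *)
Definition local_energy (h : G -> R) (x : G) : R :=
  \sum_y conductance x y * (h x - h y) ^+ 2.

Lemma local_energy_ge0 h x : 0 <= local_energy h x.
Proof. by apply: sumr_ge0 => y _; rewrite mulr_ge0 ?conductance_ge0 ?sqr_ge0. Qed.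

(* The AM-GM form of the Cauchy-Schwarz inequality along the path. *)
Lemma path_difference (h : G -> R) (lam : R) (u : G) (p : seq G) :
  0 < lam -> path (@adj G) u p ->
  h (last u p) - h u <=
    lam / 2 * (\sum_(x <- u :: p) deg x)%:R +
    (2 * lam)^-1 * \sum_(x <- u :: p) local_energy h x.
Proof.
move=> lam0; elim: p u => [|y p IH] u /=.
  move=> _; rewrite subrr !big_seq1.
  have l0 := ltW lam0; rewrite addr_ge0 ?mulr_ge0 ?local_energy_ge0 ?invr_ge0 ?mulr_ge0//.
move=> /andP[uy /IH le1]; rewrite [in leRHS]big_cons.
rewrite [\sum_(x <- u :: _) local_energy h x]big_cons natrD !mulrDr.
suff : h y - h u <= lam / 2 * (deg u)%:R + (2 * lam)^-1 * local_energy h u.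
  by move: le1; lra.
set r : R := (deg u)%:R.
have r0 : 0 < r by rewrite ltr0n (adj_deg_gt0 uy).
have cr : r^-1 <= conductance u y.
  by rewrite -[leLHS]mul1r ler_pdivrMr// mulrC conductance_deg.
(* With [d = h y - h u], completing the square gives [d <= lam r / 2 + d^2 / (2 lam r)]. *)
apply: (@le_trans _ _ (lam / 2 * r + (2 * lam)^-1 * (r^-1 * (h u - h y) ^+ 2))).
  have -> : lam / 2 * r + (2 * lam)^-1 * (r^-1 * (h u - h y) ^+ 2) =
     (h y - h u) + (lam * r - (h y - h u)) ^+ 2 / (2 * lam * r).
    by field; rewrite !gt_eqF.
  by rewrite lerDl divr_ge0 ?sqr_ge0// !mulr_ge0// ltW.
rewrite lerD2l; apply: ler_wpM2l; first by rewrite invr_ge0 mulr_ge0// ltW.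
apply: (@le_trans _ _ (conductance u y * (h u - h y) ^+ 2)).
  by rewrite ler_wpM2r ?sqr_ge0.
rewrite /local_energy (bigD1 y)//= lerDl.
by apply: sumr_ge0 => z _; rewrite mulr_ge0 ?conductance_ge0 ?sqr_ge0.
Qed.

(** Summation by parts: expand the square; symmetry of the conductances merges the two square
    terms. *)
Lemma sum_local_energy (h : G -> R) : \sum_x local_energy h x =
  2 * \sum_x h x * (total_conductance x * h x - \sum_y conductance x y * h y).
Proof.
pose A := \sum_x \sum_y conductance x y * h x ^+ 2.
pose B := \sum_x \sum_y conductance x y * (h x * h y).
have -> : \sum_x local_energy h x = 2 * (A - B).
  have AE : A = \sum_x \sum_y conductance x y * h y ^+ 2.
    rewrite /A exchange_big /=; apply: eq_bigr => x _; apply: eq_bigr => y _.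
    by rewrite conductance_sym.
  have -> : 2 * (A - B) = A + A - B - B by ring.
  rewrite {2}AE /A /B -!big_split -!sumrB /=; apply: eq_bigr => x _.
  rewrite -!big_split -!sumrB /=; apply: eq_bigr => y _; ring.
congr (2 * _); rewrite /A /B -sumrB; apply: eq_bigr => x _.
rewrite mulrBr mulrCA -expr2 -/(h x ^+ 2) mulr_suml mulr_sumr; congr (_ - _).
by apply: eq_bigr => y _; rewrite mulrCA.
Qed.

Lemma potential_le (h : G -> R) (v : G) :
  connected_graph G -> (forall x, 0 <= h x) -> h v = 0 ->
  (forall x, x != v ->
    total_conductance x * h x <=
    total_conductance x + \sum_y conductance x y * h y) ->
  forall x, h x <= 12 * #|G|%:R ^+ 2.
Proof.
move=> conn h0 hv sub.
pose a := [arg max_(x > v) h x]%O.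
have amax x : h x <= h a by rewrite /a; case: arg_maxP => // i _; exact.
move=> x; apply: le_trans (amax x) _ => {x}.
have M0 := h0 a; move: M0 amax; set M := h a => M0 amax.
have [p [pP pa pU pdeg]] := shortest_path_deg (conn v a).
have n0 : 0 < #|G|%:R :> R by rewrite ltr0n; apply/card_gt0P; exists v.
have E : \sum_x local_energy h x <= 4 * M * #|G|%:R.
  rewrite sum_local_energy.
  have : \sum_x h x * (total_conductance x * h x - \sum_y conductance x y * h y)
         <= \sum_x M * total_conductance x.
    (* At [v], where [sub] says nothing, the term vanishes because [h v = 0]. *)
    apply: ler_sum => x _; have [->|xv] := eqVneq x v.
      by rewrite hv mul0r mulr_ge0// sumr_ge0// => y _; exact: conductance_ge0.
    have tx : 0 <= total_conductance x by apply: sumr_ge0 => y _; exact: conductance_ge0.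
    apply: (@le_trans _ _ (h x * total_conductance x)); last by rewrite ler_wpM2r.
    by rewrite ler_wpM2l// lerBlDr sub.
  rewrite -mulr_sumr => le1.
  have := ler_wpM2l M0 sum_total_conductance; lra.
(* The path has no repetition, so its vertices take at most the whole energy. *)
have pE : \sum_(x <- v :: p) local_energy h x <= 4 * M * #|G|%:R.
  apply: le_trans E; rewrite big_uniq// [leRHS](bigID (mem (v :: p)))/= lerDl.
  by apply: sumr_ge0 => y _; exact: local_energy_ge0.
(* With n vertices, [lam = 4 n] turns the energy term into [M / 2], absorbed on the left, and the
   degree term into [6 n^2]; hence [M <= 12 n^2]. *)
have lam0 : 0 < 4 * #|G|%:R :> R by rewrite mulr_gt0.
have := path_difference h lam0 pP; rewrite pa hv subr0 -/M.
set S := \sum_(_ <- _) local_energy _ _ in pE *; set D := (\sum_(_ <- _) _)%:R => le1.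
have D3 : D <= 3 * #|G|%:R by rewrite -natrM ler_nat.
have S2 : (2 * (4 * #|G|%:R))^-1 * S <= M / 2.
  rewrite mulrC ler_pdivrMr ?mulr_gt0//; lra.
have D2 : 4 * #|G|%:R / 2 * D <= 4 * #|G|%:R / 2 * (3 * #|G|%:R).
  by rewrite ler_wpM2l// divr_ge0// ltW.
rewrite expr2; lra.
Qed.

End mindeg_conductance.

(** * Avoidance probabilities, computed by recursion on the first step *)

Section avoidance.
Variables (R : realType) (V : finType) (P : V -> V -> R).
Hypothesis P_ge0 : forall x y, 0 <= P x y.
Hypothesis P_sum1 : forall x, \sum_y P x y = 1.

(* The probability that the chain started at [x] does not visit [v] at the
   times 0, ..., t. *)
Fixpoint avoid (v : V) (t : nat) (x : V) : R :=
  if x == v then 0 else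
  if t is t'.+1 then \sum_y P x y * avoid v t' y else 1.

Lemma avoidS v t x : avoid v t.+1 x =
  if x == v then 0 else \sum_y P x y * avoid v t y.
Proof. by []. Qed.

Lemma avoid_target v t : avoid v t v = 0.
Proof. by case: t => [|t] /=; rewrite eqxx. Qed.

Lemma avoid_ge0 v t x : 0 <= avoid v t x.
Proof.
elim: t x => [|t IH] x /=; case: ifP => // _.
by apply: sumr_ge0 => y _; rewrite mulr_ge0.
Qed.

Lemma avoid_le1 v t x : avoid v t x <= 1.
Proof.
elim: t x => [|t IH] x /=; case: ifP => // _.
by rewrite -(P_sum1 x); apply: ler_sum => y _; rewrite ler_piMr.
Qed.

Lemma avoid_nincr v s t x : (s <= t)%N -> avoid v t x <= avoid v s x.
Proof.
move=> /subnK <-; elim: (t - s)%N => // k; apply: le_trans.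
rewrite addSn; elim: (k + s)%N x => [|m IH] x.
  by have := avoid_le1 v 1 x; rewrite /=; case: ifP.
rewrite [leRHS]avoidS avoidS; case: ifP => // _.
by apply: ler_sum => y _; rewrite ler_wpM2l.
Qed.

(** Markov property at time [m]: a walk still avoiding [v] restarts from a vertex where the bound
    [c] holds. A list of times covers both a single time ([avoid_pow]) and a whole range (the tail
    in [sum_uncovered_le]). *)
Lemma avoid_add v m (r : seq nat) (c : R) :
  (forall x, \sum_(s <- r) avoid v s x <= c) ->
  forall x, \sum_(s <- r) avoid v (m + s) x <= c * avoid v m x.
Proof.
move=> rc; elim: m => [|m IH] x.
  rewrite /=; case: eqVneq => [->|_]; last by rewrite mulr1 rc.
  by rewrite mulr0 big1// => s _; rewrite avoid_target.
under eq_bigr do rewrite addSn.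
rewrite /=; case: eqVneq => [_|_]; first by rewrite mulr0 big1.
rewrite exchange_big /= mulr_sumr; apply: ler_sum => y _.
by rewrite -mulr_sumr mulrCA ler_wpM2l.
Qed.

Lemma avoid_pow v T (c : R) : 0 <= c -> (forall x, avoid v T x <= c) ->
  forall k x, avoid v (k * T) x <= c ^+ k.
Proof.
move=> c0 Tc; elim=> [|k IH] x; first by rewrite mul0n expr0 avoid_le1.
have := @avoid_add v T [:: (k * T)%N] (c ^+ k).
move=> /(_ _ x); rewrite big_seq1 -mulSn => /(_ _)/le_trans -> //.
  by move=> y; rewrite big_seq1.
by rewrite exprSr ler_wpM2l// exprn_ge0.
Qed.

(** The sum is the expectation of the hitting time of [v] truncated at [N]; this is its first-step
    equation, an inequality because of the truncation. *)
Lemma occupation_le v N x : x != v ->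
  \sum_(0 <= t < N) avoid v t x <=
  1 + \sum_y P x y * \sum_(0 <= t < N) avoid v t y.
Proof.
move=> xv; apply: (@le_trans _ _ (\sum_(0 <= t < N.+1) avoid v t x)).
  by rewrite big_nat_recr//= lerDl avoid_ge0.
rewrite big_nat_recl//= (negbTE xv) lerD2l.
by rewrite exchange_big /=; apply: ler_sum => y _; rewrite mulr_sumr.
Qed.

(* After [K * T] steps the expected remaining time to reach [v] has shrunk by
   [2 ^ K], which beats the union bound over [v]. *)
Lemma sum_uncovered_le (B : R) (T K : nat) (u : V) (q : nat -> R) :
  (forall v N x, \sum_(0 <= t < N) avoid v t x <= B) ->
  2 * B <= T.+1%:R -> (#|V| <= 2 ^ K)%N ->
  (forall t, 0 <= q t) -> (forall t, q t <= 1) ->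
  (forall t, q t <= \sum_v avoid v t u) ->
  forall N, \sum_(0 <= t < N) q t <= (K * T)%:R + B.
Proof.
move=> hB BT VK q0 q1 qV N.
(* Markov's inequality: [avoid] decreases in time, so [T + 1] times its value at [T] is at most
   [B]. *)
have half v x : avoid v T x <= 2^-1.
  have : \sum_(0 <= t < T.+1) avoid v T x <= B.
    apply: le_trans (hB v T.+1 x); rewrite !big_nat; apply: ler_sum => t /andP[_ tT].
    exact: avoid_nincr.
  rewrite sumr_const_nat subn0 -mulr_natl => TB.
  have := ler0n R T; rewrite -natr1 in TB BT.
  by have := avoid_ge0 v T x; nra.
(* Enlarging the range allows a split at [K * T] whatever [N] is; the first [K * T] terms are
   bounded by 1 each. *)
apply: (@le_trans _ _ (\sum_(0 <= t < K * T + N) q t)).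
  rewrite [leRHS](big_cat_nat (n := N)) ?leq_addl//= lerDl.
  by apply: sumr_ge0.
rewrite (big_cat_nat (n := K * T)%N) ?leq_addr//= lerD//.
  rewrite -[leRHS]mulr1 mulr_natl -[X in _ *+ X]subn0 -sumr_const_nat.
  by apply: ler_sum.
rewrite -{1}[(K * T)%N]add0n big_addn addKn.
(* For each [v], surviving [K] rounds of length [T] costs [2^-K], and the remaining expected time is
   at most [B]. *)
apply: (@le_trans _ _ (\sum_(v : V) B * (2^-1) ^+ K)); last first.
  rewrite sumr_const -[leRHS]mulr1 -mulrnAr ler_wpM2l//.
    by have := hB u 0%N u; rewrite big_geq.
  rewrite exprVn -mulr_natl ler_pdivrMr ?exprn_gt0// mul1r.
  by rewrite -natrX ler_nat.
apply: (@le_trans _ _ (\sum_(0 <= s < N) \sum_v avoid v (K * T + s) u)).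
  by apply: ler_sum => s _; rewrite addnC.
rewrite exchange_big /=; apply: ler_sum => v _.
apply: le_trans (avoid_add _ (hB v N) u) _.
rewrite ler_wpM2l//; first by have := hB u 0%N u; rewrite big_geq.
by apply: avoid_pow.
Qed.

End avoidance.

Lemma measure_bigsetU_le d (T : measurableType d) (R : realType)
    (mu : {measure set T -> \bar R}) (I : Type) (r : seq I) (F : I -> set T) :
  (forall i, measurable (F i)) ->
  (mu (\big[setU/set0]_(i <- r) F i) <= \sum_(i <- r) mu (F i))%E.
Proof.
move=> mF; elim: r => [|i r IH]; first by rewrite !big_nil measure0.
rewrite !big_cons; apply: (le_trans (measureU2 _ _ _)) => //.
  by apply: bigsetU_measurable => j _.
by rewrite leeD2l.
Qed.

Lemma bigcup_fintype (I : finType) (T : Type) (F : I -> set T) :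
  \big[setU/set0]_i F i = \bigcup_i F i.
Proof.
rewrite -(bigcup_seq (index_enum I)).
by apply: eq_bigcupl; split=> i //= _; exact: mem_index_enum.
Qed.

(** * From the law on trajectories to avoidance probabilities and the cover time *)

Section no_visit.
Variables (R : realType) (V : finType) (P : V -> V -> R) (u : V).
Variable mu : probability (path_space u) R.
Hypothesis P_ge0 : forall x y, 0 <= P x y.
Hypothesis muP : is_chain_law P mu.

(** The window starts at an arbitrary [t] so that the induction in [cylinder_no_visit_le] can shift
    it; afterwards only [t = 0] occurs. *)
Definition no_visit (v : V) (t k : nat) : set (path_space u) :=
  [set X | forall i, (t <= i <= t + k)%N -> X i <> v].

Definition uncovered (t : nat) : set (path_space u) :=
  [set X | exists v, forall s, (s <= t)%N -> X s <> v].

Lemma measurable_no_visit v t k : measurable (no_visit v t k).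
Proof.
rewrite (_ : no_visit v t k =
  \bigcap_(i in [set i | (t <= i <= t + k)%N]) ~` [set X : path_space u | X i = v]).
  apply: bigcap_measurable.
    by exists t; rewrite /= leqnn leq_addr.
  by move=> i _; apply: measurableC; exact: measurable_coordinate.
by apply/seteqP; split.
Qed.

Lemma uncoveredE t : uncovered t = \big[setU/set0]_(v : V) no_visit v 0 t.
Proof.
by rewrite bigcup_fintype; apply/seteqP; split=> [X [v Xv]|X [v _ Xv]]; exists v.
Qed.

Lemma measurable_uncovered t : measurable (uncovered t).
Proof.
rewrite uncoveredE; apply: bigsetU_measurable => v _; exact: measurable_no_visit.
Qed.

(** Markov property on cylinders, by splitting on the value of [X t.+1]. Only an upper bound is
    needed, so subadditivity replaces a disjoint decomposition. *)
Lemma cylinder_no_visit_le v k t (x : nat -> V) :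
  (mu (cylinder u x t `&` no_visit v t k) <=
   mu (cylinder u x t) * (avoid P v k (x t))%:E)%E.
Proof.
elim: k t x => [|k IH] t x.
  rewrite /=; case: eqVneq => [xv|_].
    rewrite mule0 (_ : _ `&` _ = set0) ?measure0//.
    apply/seteqP; split=> X //= [Xx /(_ t)]; rewrite leqnn leq_addr Xx//.
    by move=> /(_ erefl).
  rewrite mule1; apply: le_measure; rewrite ?inE.
  - by apply: measurableI; [exact: measurable_cylinder|exact: measurable_no_visit].
  - exact: measurable_cylinder.
  - by move=> X [].
rewrite avoidS; case: eqVneq => [xv|_].
  rewrite mule0 (_ : _ `&` _ = set0) ?measure0//.
  apply/seteqP; split=> X //= [Xx /(_ t)]; rewrite leqnn leq_addr Xx//.
  by move=> /(_ erefl).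
(* [ext y] prolongs the prefix of [x] up to [t] by the value [y] at [t.+1]. *)
pose ext y i := if (i <= t)%N then x i else y.
pose F y := cylinder u (ext y) t.+1 `&` no_visit v t.+1 k.
have mF y : measurable (F y).
  by apply: measurableI; [exact: measurable_cylinder|exact: measurable_no_visit].
apply: (@le_trans _ _ (mu (\big[setU/set0]_(y : V) F y))).
  apply: le_measure; rewrite ?inE.
  - by apply: measurableI; [exact: measurable_cylinder|exact: measurable_no_visit].
  - exact: bigsetU_measurable.
  - move=> X [Xx Xv]; rewrite bigcup_fintype; exists (X t.+1) => //; split.
      move=> i it; rewrite /ext; case: leqP => [/Xx //|ti].
      by congr X; apply/eqP; rewrite eqn_leq it ti.
    by move=> i /andP[ti ik]; apply: Xv; rewrite (ltnW ti) addnS -addSn.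
apply: le_trans (measure_bigsetU_le mu _ mF) _.
apply: (@le_trans _ _ (\sum_(y : V)
    (mu (cylinder u x t) * (P (x t) y * avoid P v k y)%:E))%E); last first.
  rewrite -ge0_sume_distrr ?sumEFin// => y _.
  by rewrite lee_fin mulr_ge0 ?avoid_ge0.
apply: lee_sum => y _; apply: le_trans (IH _ _) _.
have [_ ->] := muP.
have -> : cylinder u (ext y) t = cylinder u x t.
  by apply/seteqP; split=> X Xx i it; rewrite Xx // /ext it.
by rewrite /ext leqnn ltnn EFinM muleA.
Qed.

Lemma no_visit_le v k : (mu (no_visit v 0 k) <= (avoid P v k u)%:E)%E.
Proof.
pose F y := cylinder u (fun=> y) 0 `&` no_visit v 0 k.
have mF y : measurable (F y).
  by apply: measurableI; [exact: measurable_cylinder|exact: measurable_no_visit].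
apply: (@le_trans _ _ (mu (\big[setU/set0]_(y : V) F y))).
  apply: le_measure; rewrite ?inE.
  - exact: measurable_no_visit.
  - exact: bigsetU_measurable.
  - move=> X Xv; rewrite bigcup_fintype; exists (X 0%N) => //; split=> //.
    by move=> i; rewrite leqn0 => /eqP ->.
apply: le_trans (measure_bigsetU_le mu _ mF) _.
apply: (@le_trans _ _ (\sum_(y : V) ((y == u)%:R * avoid P v k y)%:E)%E).
  apply: lee_sum => y _; apply: le_trans (cylinder_no_visit_le _ _ _ _) _.
  by rewrite (chain_law_cylinder _ _ muP) big_ord0 mulr1 -EFinM.
rewrite sumEFin lee_fin (bigD1 u)//= eqxx mul1r big1 ?addr0// => y /negbTE ->.
by rewrite mul0r.
Qed.

Lemma uncovered_le t : (mu (uncovered t) <= (\sum_v avoid P v t u)%:E)%E.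
Proof.
rewrite uncoveredE; apply: le_trans (measure_bigsetU_le mu _ _) _.
  by move=> v; exact: measurable_no_visit.
by rewrite -sumEFin; apply: lee_sum => v _; exact: no_visit_le.
Qed.

(** Layer-cake formula: [uncovered t] is the event that the cover time exceeds [t], so the series is
    a run of ones, infinite exactly when some vertex is never visited. *)
Lemma cover_timeE (X : path_space u) :
  cover_time R X = (\sum_(0 <= t <oo) (\1_(uncovered t) X)%:E)%E.
Proof.
have [ex|nex] := pselect (exists t, ~ uncovered t X).
- have ex' : exists t, `[< ~ uncovered t X >].
    by case: ex => t tX; exists t; exact/asboolP.
  case: (ex_minnP ex') => m /asboolP mX mmin.
  have lt_m t : (t < m)%N -> uncovered t X.
    move=> tm; apply: contrapT => tX.
    by have := mmin t (asboolT tX); rewrite leqNgt tm.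
  have ge_m t : (m <= t)%N -> ~ uncovered t X.
    move=> mt [v Xv]; apply: mX; exists v => s sm.
    exact: Xv (leq_trans sm mt).
  rewrite (nneseries_split 0 m); last by move=> k _; rewrite lee_fin.
  rewrite add0n [X in (_ + X)%E]eseries0; last first.
    by move=> i mi _; rewrite indicE memNset//; exact: ge_m.
  rewrite adde0 big_nat (eq_bigr (fun=> 1%E)); last first.
    by move=> i /andP[_ im]; rewrite indicE mem_set//; exact: lt_m.
  rewrite -big_nat sumEFin sumr_const_nat subn0.
  apply/eqP; rewrite eq_le; apply/andP; split.
    apply: ereal_inf_lbound; exists m => // v.
    apply: contrapT => mv; apply: mX; exists v => s sm Xs; apply: mv.
    by exists s.
  apply/ereal_infP => _ [t tX <-]; rewrite lee_fin ler_nat leqNgt.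
  apply/negP => /lt_m[v vX]; have [s st Xs] := tX v.
  exact: vX s st Xs.
- have un t : uncovered t X by apply: contrapT => tX; apply: nex; exists t.
  have -> : cover_time R X = +oo%E.
    rewrite /cover_time (_ : [set _ | _ in _] = set0) ?ereal_inf0//.
    apply/seteqP; split=> y /=; last by []. case=> t tX _.
    have [v vX] := un t; have [s st Xs] := tX v.
    exact: vX s st Xs.
  apply/esym/eq_infty => r; pose n := (Num.truncn `|r|).+1.
  have rn : r <= n%:R.
    by apply: le_trans (ler_norm r) (ltW _); rewrite truncnS_gt.
  apply: (@le_trans _ _ (\sum_(0 <= t < n) (\1_(uncovered t) X)%:E)%E).
    rewrite (eq_bigr (fun=> 1%E)) => [|i _]; last by rewrite indicE mem_set.
    by rewrite sumEFin sumr_const_nat subn0 lee_fin.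
  by apply: nneseries_lim_ge => k _ _; rewrite lee_fin.
Qed.

Lemma integral_cover_time : (\int[mu]_X cover_time R X =
  \sum_(0 <= t <oo) mu (uncovered t))%E.
Proof.
under eq_integral do rewrite cover_timeE.
rewrite integral_nneseries//=; last first.
  move=> t; apply/measurable_EFinP; apply: measurable_indic.
  exact: measurable_uncovered.
apply: eq_eseriesr => t _; rewrite integral_indic ?setIT//.
exact: measurable_uncovered.
Qed.

Lemma integral_cover_time_le (B : R) (T K : nat) :
  (forall x, \sum_y P x y = 1) ->
  (forall v N x, \sum_(0 <= t < N) avoid P v t x <= B) ->
  2 * B <= T.+1%:R -> (#|V| <= 2 ^ K)%N ->
  (\int[mu]_X cover_time R X <= ((K * T)%:R + B)%:E)%E.
Proof.
move=> P1 hB BT VK; rewrite integral_cover_time.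
have muE t : mu (uncovered t) = (fine (mu (uncovered t)))%:E.
  by rewrite fineK// fin_num_measure//; exact: measurable_uncovered.
apply: lime_le; first by apply: is_cvg_nneseries => t _ _.
apply: nearW => N; under eq_bigr do rewrite muE.
rewrite sumEFin lee_fin; apply: (sum_uncovered_le P_ge0 P1 (u := u) hB) => // t.
- exact: fine_ge0.
- by rewrite -lee_fin -muE; apply: probability_le1; exact: measurable_uncovered.
- by rewrite -lee_fin -muE; exact: uncovered_le.
Qed.

End no_visit.

(** * Application to the min-deg walk and the final constant *)

Section mindeg_cover_time.
Variables (R : realType) (G : sgraph).
Hypothesis Gconn : connected_graph G.
Hypothesis G2 : (2 <= #|G|)%N.

Let W := weighted_trans (@mindeg_weight R G).

Lemma mindeg_occupation_le (v : G) N x :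
  \sum_(0 <= t < N) avoid W v t x <= 12 * #|G|%:R ^+ 2.
Proof.
have W0 : forall x y, 0 <= W x y := @mindeg_trans_ge0 R G.
pose h x := \sum_(0 <= t < N) avoid W v t x.
have h0 y : 0 <= h y by apply: sumr_ge0 => t _; exact: avoid_ge0.
apply: (@potential_le R G h v Gconn h0).
  by rewrite /h big1// => t _; rewrite avoid_target.
move=> y yv; have tc0 : 0 <= total_conductance R y.
  by apply: sumr_ge0 => z _; exact: conductance_ge0.
(* A zero total conductance could not be cancelled against the quotient in [weighted_transE]; the
   left side is then 0. *)
have [tcE|tcN0] := eqVneq (total_conductance R y) 0.
  by rewrite tcE mul0r add0r sumr_ge0// => z _; rewrite mulr_ge0 ?conductance_ge0.
apply: le_trans (ler_wpM2l tc0 (occupation_le W0 N yv)) _.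
rewrite mulrDr mulr1 lerD2l mulr_sumr; apply: ler_sum => z _.
by rewrite /W weighted_transE mulrA mulrCA divff// mulr1.
Qed.

Lemma mindeg_expected_cover_time_le (u : G) :
  (expected_cover_time W u <=
   ((up_log 2 #|G| * (24 * #|G| ^ 2))%:R + 12 * #|G|%:R ^+ 2)%:E)%E.
Proof.
(* Here [B = 12 n^2], [T = 24 n^2 = 2 B] and [K = up_log 2 n]. *)
apply: (integral_cover_time_le (P := W)).
- exact: mindeg_trans_ge0.
- exact: mindeg_lawP.
- exact: mindeg_trans_sum1.
- exact: mindeg_occupation_le.
- rewrite -[leRHS]natr1 natrM natrX; lra.
- by case/andP: (up_log_bounds (isT : (1 < 2)%N) G2).
Qed.

End mindeg_cover_time.

(** Minimality of [k = up_log 2 n] gives [2^(k-1) < n]; take logarithms. *)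
Lemma up_log_ln_le (R : realType) (n : nat) : (2 <= n)%N ->
  (up_log 2 n)%:R <= ln n%:R / ln 2 + 1 :> R.
Proof.
move=> n2; have /andP[+ _] := up_log_bounds (isT : (1 < 2)%N) n2.
have ln2 : 0 < ln 2 :> R by rewrite ln_gt0// ltr1n.
set k := up_log 2 n => kn.
have : (2 : R) ^+ k.-1 <= n%:R by rewrite -natrX ler_nat ltnW.
rewrite -ler_ln ?posrE ?exprn_gt0 ?ltr0n//; last exact: leq_trans n2.
rewrite lnXn// -[_ *+ _]mulr_natl -ler_pdivlMr// => le1.
have : (k%:R : R) <= k.-1%:R + 1 by rewrite natr1 ler_nat leqSpred.
by move/le_trans; apply; rewrite lerD2r.
Qed.

Theorem corollary69 (R : realType) :
  exists C : R, forall G : sgraph, connected_graph G -> (2 <= #|G|)%N ->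
    (COV (@mindeg_weight R G) <= (C * #|G|%:R ^+ 2 * ln #|G|%:R)%:E)%E.
Proof.
(* With [y = ln n / ln 2 >= 1], the coefficient of [n^2] is at most [24 (y + 1) + 12 <= 72 y]. *)
exists (72 / ln 2) => G Gconn G2; apply: bigmax_le; first exact: leNye.
move=> u _; apply: le_trans (mindeg_expected_cover_time_le R Gconn G2 u) _.
rewrite lee_fin natrM natrM natrX.
have ln2 : 0 < ln 2 :> R by rewrite ln_gt0// ltr1n.
have y1 : 1 <= ln #|G|%:R / ln 2 :> R.
  by rewrite ler_pdivlMr// mul1r ler_ln ?posrE ?ltr0n ?ler_nat// (leq_trans _ G2).
have := up_log_ln_le R G2; set k := (up_log _ _)%:R => ky.
rewrite (_ : 72 / ln 2 * _ * _ = 72 * #|G|%:R ^+ 2 * (ln #|G|%:R / ln 2)); last first.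
  by field; rewrite gt_eqF.
set y := ln _ / _ in y1 ky *; have n0 : 0 <= #|G|%:R ^+ 2 :> R by rewrite sqr_ge0.
by nra.
Qed.
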